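(* Let $\mathcal{B}=(\mathcal{O},\mathscr{C},\mathfrak{R},I,T)$ be a synchronously unambiguous bud generating system, with $\mathscr{C}=\{c_1,\dots,c_k\}$, such that $\mathcal{O}$ is a locally finite operad and $\mathfrak{R}(1)$ finitely factorizes $\mathbf{Bud}_{\mathscr{C}}(\mathcal{O})$. Let $\mathbf{f}$ be the series of $\mathbb{K}[[\mathbb{X}_{\mathscr{C}}\sqcup\mathbb{Y}_{\mathscr{C}}]]$ satisfying, for any $a\in\mathscr{C}$ and any type $\alpha\in\mathcal{T}_{\mathscr{C}}$, $$\langle\mathsf{x}_a\mathbb{Y}_{\mathscr{C}}^\alpha,\mathbf{f}\rangle=\delta_{\alpha,\mathrm{type}(a)}+\sum_{\substack{\phi:\mathscr{C}\times\mathcal{T}_{\mathscr{C}}\to\mathbb{N}\\ \alpha=\phi^{(c_1)}\dots\phi^{(c_k)}}}\Bigl(\prod_{b\in\mathscr{C}}\phi_b!\Bigr)\Bigl(\prod_{\substack{b\in\mathscr{C}\\ \gamma\in\mathcal{T}_{\mathscr{C}}}}\chi_{b,\gamma}^{\phi(b,\gamma)}\Bigr)\Bigl\langle\mathsf{x}_a\prod_{b\in\mathscr{C}}\mathsf{y}_b^{\sum\phi_b},\mathbf{f}\Bigr\rangle.$$ Then, for any color $a\in I$ and any type $\alpha\in\mathcal{T}_{\mathscr{C}}$ such that $\mathscr{C}^\alpha\in T^+$, the coefficients $\langle\mathsf{x}_a\mathbb{Y}_{\mathscr{C}}^\alpha,\mathrm{colt}(\mathrm{sync}(\mathcal{B}))\rangle$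 and $\langle\mathsf{x}_a\mathbb{Y}_{\mathscr{C}}^\alpha,\mathbf{f}\rangle$ are equal.
   Context: Colored operads. Let $\mathscr{C}=\{c_1,\dots,c_k\}$ be a finite set of colors. A $\mathscr{C}$-colored operad $\mathcal{C}=\bigsqcup_{n\geq1}\mathcal{C}(n)$ is a nonsymmetric colored set-operad: each $x\in\mathcal{C}(n)$ has arity $|x|=n$, an output color $\mathrm{out}(x)\in\mathscr{C}$ and a word of input colors $\mathrm{in}(x)\in\mathscr{C}^n$ with $i$-th letter $\mathrm{in}_i(x)$; $x\circ_i y\in\mathcal{C}(|x|+|y|-1)$ is defined iff $\mathrm{out}(y)=\mathrm{in}_i(x)$; there are units $\mathbf{1}_a\in\mathcal{C}(1)$, $a\in\mathscr{C}$, with output and input color $a$; the usual associativity and unit axioms hold. The complete composition is $x\circ[y_1,\dots,y_n]:=(\cdots((x\circ_n y_n)\circ_{n-1}y_{n-1})\cdots)\circ_1 y_1$ (defined when $\mathrm{out}(y_i)=\mathrm{in}_i(x)$ for all $i$). A (monochrome) operad is the case of a single color. $\mathcal{C}$ is locally finite if every $\mathcal{C}(n)$ is finite. Bud operads. For an operad $\mathcal{O}$ with unit $\mathbf{1}$, $\mathbf{Bud}_{\mathscr{C}}(\mathcal{O})$ is the $\mathscr{C}$-colored operad of triples $(a,x,u)\in\mathscr{C}\times\mathcal{O}(n)\times\mathscr{C}^n$, $n\geq1$, with output color $a$, input colors $u$, units $\mathbf{1}_a=(a,\mathbf{1},a)$, and $(a,x,u)\circ_i(b,y,v)=(a,x\circ_i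 y,u')$ when $b=u_i$, where $u'$ is $u$ with its $i$-th letter replaced by $v$. A bud generating system is a tuple $\mathcal{B}=(\mathcal{O},\mathscr{C},\mathfrak{R},I,T)$ with $\mathcal{O}$ an operad, $\mathscr{C}$ a finite set of colors, $\mathfrak{R}$ a finite subset of $\mathbf{Bud}_{\mathscr{C}}(\mathcal{O})$ (rules) and $I,T\subseteq\mathscr{C}$. $T^+$ is the set of nonempty words on $T$. Finite factorization. For a subset $S$ of a $\mathscr{C}$-colored operad $\mathcal{C}$, $S(1)$ is the set of its elements of arity $1$, and $\mathbf{Free}(S)$ is the set of planar rooted trees whose internal nodes with $n\geq1$ children are labeled by arity-$n$ elements of $S$, such that if $v$ is the $i$-th child of $u$ (both internal) then the output color of the label of $v$ is the $i$-th input color of the label of $u$; it contains, for each color $a$, a tree consisting of one leaf with output and input color $a$. The evaluation $\mathrm{ev}_{\mathcal{C}}(\mathfrak{t})\in\mathcal{C}$ is obtained by composing in $\mathcal{C}$ the labels along $\mathfrak{t}$ (the one-leaf tree of color $a$ evaluates to $\mathbf{1}_a$). $S$ finitely factorizes $\mathcal{C}$ if for each $x\in\mathcal{C}$ there are finitely many $\mathfrak{t}\in\mathbf{Free}(S)$ with $\mathrm{ev}_{\mathcal{C}}(\mathfrak{t})=x$. Series. $\mathbb{K}$ is a field of characteristic zero. A $\mathcal{C}$-series is a map $\mathbf{f}:\mathcal{C}\to\mathbb{K}$, with values denoted $\langle x,\mathbf{f}\rangle$. The characteristic series of a subset is its indicator function. $\mathbf{u}$ is the characteristic series of $\{\mathbf{1}_a:a\in\mathscr{C}\}$.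 Composition product: $\langle x,\mathbf{f}\odot\mathbf{g}\rangle:=\sum_{y,z_1,\dots,z_{|y|}\in\mathcal{C},\,x=y\circ[z_1,\dots,z_{|y|}]}\langle y,\mathbf{f}\rangle\prod_{i}\langle z_i,\mathbf{g}\rangle$; on a locally finite colored operad it is associative with unit $\mathbf{u}$. $\mathbf{f}^{\odot_\ell}$ is the $\ell$-fold $\odot$-product of $\mathbf{f}$ with itself ($\mathbf{f}^{\odot_0}=\mathbf{u}$), and $\mathbf{f}^{\odot_*}:=\sum_{\ell\geq0}\mathbf{f}^{\odot_\ell}$. Let $\mathbf{r}$, $\mathbf{i}$, $\mathbf{t}$ be the characteristic series of $\mathfrak{R}$, $\{\mathbf{1}_a:a\in I\}$, $\{\mathbf{1}_a:a\in T\}$ in $\mathbf{Bud}_{\mathscr{C}}(\mathcal{O})$. The synchronous generating series is $\mathrm{sync}(\mathcal{B}):=\mathbf{i}\odot\mathbf{r}^{\odot_*}\odot\mathbf{t}$ (well-defined when $\mathcal{O}$ is locally finite and $\mathfrak{R}(1)$ finitely factorizes $\mathbf{Bud}_{\mathscr{C}}(\mathcal{O})$). $\mathcal{B}$ is synchronously unambiguous if all coefficients of $\mathrm{sync}(\mathcal{B})$ are equal to $0$ or $1$. Types. The type of a nonempty word $u$ on $\mathscr{C}$ is $\mathrm{type}(u)=|u|_{c_1}\dots|u|_{c_k}\in\mathbb{N}^k$, where $|u|_c$ is the number of occurrences of $c$ in $u$. $\mathcal{T}_{\mathscr{C}}$ is the set of all types, i.e. of all nonzero elements of $\mathbb{N}^k$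 (written as words of length $k$). For a type $\alpha$, $\mathscr{C}^\alpha$ is the word $c_1^{\alpha_1}\dots c_k^{\alpha_k}$. $\mathbb{X}_{\mathscr{C}}=\{\mathsf{x}_{c_1},\dots,\mathsf{x}_{c_k}\}$ and $\mathbb{Y}_{\mathscr{C}}=\{\mathsf{y}_{c_1},\dots,\mathsf{y}_{c_k}\}$ are sets of commuting variables, $\mathbb{Y}_{\mathscr{C}}^\alpha=\mathsf{y}_{c_1}^{\alpha_1}\cdots\mathsf{y}_{c_k}^{\alpha_k}$, and $\langle m,\mathbf{s}\rangle$ is the coefficient of the monomial $m$ in $\mathbf{s}$. The series of color types of a $\mathcal{C}$-series $\mathbf{g}$ is $\mathrm{colt}(\mathbf{g})=\sum_{x\in\mathcal{C}}\langle x,\mathbf{g}\rangle\,\mathsf{x}_{\mathrm{out}(x)}\,\mathbb{Y}_{\mathscr{C}}^{\mathrm{type}(\mathrm{in}(x))}$. Notation. $\chi_{a,\gamma}:=\#\{r\in\mathfrak{R}:\mathrm{out}(r)=a,\ \mathrm{type}(\mathrm{in}(r))=\gamma\}$. The maps $\phi:\mathscr{C}\times\mathcal{T}_{\mathscr{C}}\to\mathbb{N}$ considered are those with $\phi(b,\gamma)\neq0$ for finitely many pairs only. For such $\phi$ and $a\in\mathscr{C}$, with $\gamma_a$ denoting the component of $\gamma$ corresponding to color $a$: $\phi^{(a)}:=\sum_{b\in\mathscr{C},\gamma\in\mathcal{T}_{\mathscr{C}}}\phi(b,\gamma)\gamma_a$; $\phi_a$ is the multiset of the values $\phi(a,\gamma)$,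 $\gamma\in\mathcal{T}_{\mathscr{C}}$; $\sum\phi_a:=\sum_{\gamma}\phi(a,\gamma)$; and $\phi_a!$ is the multinomial coefficient $\bigl(\sum_\gamma\phi(a,\gamma)\bigr)!\big/\prod_\gamma\phi(a,\gamma)!$. $\phi^{(c_1)}\dots\phi^{(c_k)}$ denotes an element of $\mathbb{N}^k$ written as a word. $\delta$ is the Kronecker delta and $0^0=1$. *)

(* Defs.v *)
From mathcomp Require Import all_boot all_order all_algebra finmap.
From mathcomp Require Import mathcomp_extra boolp classical_sets functions.
From mathcomp Require Import cardinality fsbigop.

Set Implicit Arguments.
Unset Strict Implicit.
Unset Printing Implicit Defensive.

Import GRing.Theory.

Local Open Scope classical_set_scope.
Local Open Scope ring_scope.

(* The word u with its i-th letter (counted from 0) replaced by the word v. *)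
Definition subst_at (A : Type) (u : seq A) (i : nat) (v : seq A) : seq A :=
  take i u ++ v ++ drop i.+1 u.

Lemma subst_at_cat (A : Type) (p q v : seq A) a :
  subst_at (p ++ a :: q) (size p) v = p ++ v ++ q.
Proof.
by rewrite /subst_at take_size_cat // -cat_rcons drop_size_cat // size_rcons.
Qed.

Lemma onth_size_cat (A : Type) (p q : seq A) a :
  onth (p ++ a :: q) (size p) = Some a.
Proof. by rewrite onth_cat ltnn subnn. Qed.

Lemma onth_split (A : Type) (u : seq A) i a : onth u i = Some a ->
  exists p q, u = p ++ a :: q /\ i = size p.
Proof.
elim: u i => [|b u IH] [|i] //= => [[->]|/IH [p [q [-> ->]]]].
  by exists [::], u.
by exists (b :: p), q.
Qed.

Lemma onth_split2 (A : Type) (u : seq A) i j a b : (i < j)%N ->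
  onth u i = Some a -> onth u j = Some b ->
  exists p q r, [/\ u = p ++ a :: q ++ b :: r, i = size p
                   & j = size (p ++ a :: q)].
Proof.
move=> ij ui; have [p [q [-> ei]]] := onth_split ui; subst i.
rewrite onth_cat ltnNge ltnW //=; case jp: (j - size p)%N => [|m].
  by move: ij; rewrite -subn_gt0 jp.
move=> /= qm; have [p' [r [-> em]]] := onth_split qm; exists p, p', r; split => //.
by rewrite size_cat /= -em -jp subnKC // ltnW.
Qed.

Lemma onth_lt (A : Type) (u : seq A) i a : onth u i = Some a -> (i < size u)%N.
Proof. by move=> h; rewrite -onthTE h. Qed.

Lemma subst_at_seqA (A : Type) (u v w : seq A) i j a b :
  onth u i = Some a -> onth v j = Some b ->
  onth (subst_at u i v) (i + j) = Some b /\
  subst_at (subst_at u i v) (i + j) w = subst_at u i (subst_at v j w).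
Proof.
move=> ui vj; have [p [q [-> ->]]] := onth_split ui.
have [p' [q' [-> ->]]] := onth_split vj.
rewrite !subst_at_cat -catA cat_cons catA -size_cat onth_size_cat subst_at_cat.
by rewrite -!catA.
Qed.

Lemma subst_at_parA (A : Type) (u v w : seq A) i j a b : (i < j)%N ->
  onth u i = Some a -> onth u j = Some b ->
  [/\ onth (subst_at u i v) (j + size v).-1 = Some b,
      onth (subst_at u j w) i = Some a
    & subst_at (subst_at u i v) (j + size v).-1 w
      = subst_at (subst_at u j w) i v].
Proof.
move=> ij ui uj; have [p [q [r [-> -> ->]]]] := onth_split2 ij ui uj.
rewrite subst_at_cat -[p ++ a :: q ++ b :: r]/(p ++ (a :: q) ++ b :: r).
rewrite [p ++ (a :: q) ++ _]catA subst_at_cat.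
have -> : (size (p ++ a :: q) + size v).-1 = size (p ++ v ++ q).
  by rewrite !size_cat /= addnS addSn /= -addnA (addnC (size q)).
rewrite -(catA p (a :: q)) cat_cons onth_size_cat subst_at_cat.
by rewrite (catA v) (catA p) onth_size_cat subst_at_cat -!catA.
Qed.

(* The arity of x is the length of its input word [inp x].  Positions are
   counted from 0.  The partial composition is given by a total function
   [pcomp], whose value at (x, i, y) is meaningful only when the composition is
   defined, i.e. when i is a position of [inp x] carrying the color [out y];
   all the axioms are restricted to this case. *)
Record colored_operad (C : finType) := ColoredOperad {
  operad_sort :> choiceType;
  out : operad_sort -> C;
  inp : operad_sort -> seq C;
  op_unit : C -> operad_sort;
  pcomp : operad_sort -> nat -> operad_sort -> operad_sort;
  inp_neq0 : forall x, inp x != [::];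
  out_unit : forall a, out (op_unit a) = a;
  inp_unit : forall a, inp (op_unit a) = [:: a];
  out_pcomp : forall x i y,
    onth (inp x) i = Some (out y) -> out (pcomp x i y) = out x;
  inp_pcomp : forall x i y,
    onth (inp x) i = Some (out y) ->
    inp (pcomp x i y) = subst_at (inp x) i (inp y);
  pcomp_seqA : forall x i y j z,
    onth (inp x) i = Some (out y) -> onth (inp y) j = Some (out z) ->
    pcomp (pcomp x i y) (i + j)%N z = pcomp x i (pcomp y j z);
  pcomp_parA : forall x i y j z,
    (i < j)%N ->
    onth (inp x) i = Some (out y) -> onth (inp x) j = Some (out z) ->
    pcomp (pcomp x i y) (j + size (inp y)).-1 z = pcomp (pcomp x j z) i y;
  pcomp1x : forall x, pcomp (op_unit (out x)) 0 x = x;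
  pcompx1 : forall x i a,
    onth (inp x) i = Some a -> pcomp x i (op_unit a) = x
}.

Notation operad := (colored_operad unit).

Section Operads.

Variables (C : finType) (P : colored_operad C).
Implicit Types (x y : P) (S : set P).

Definition arity x : nat := size (inp x).

Definition locally_finite : Prop :=
  forall n : nat, finite_set [set x : P | arity x = n].

Fixpoint ccomp_from (i : nat) x (ys : seq P) : P :=
  if ys is y :: ys' then pcomp (ccomp_from i.+1 x ys') i y else x.

(* x o [y_1, ..., y_n] = (... (x o_n y_n) o_{n-1} ...) o_1 y_1 *)
Definition ccomp x (ys : seq P) : P := ccomp_from 0 x ys.

(* x o [ys] is defined; the equation of words also says that size ys is the
   arity of x. *)
Definition ccomposable x (ys : seq P) : Prop := map (@out C P) ys = inp x.

(* A leaf carries its color.  Below a node this color is forced by the input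
   color of the parent (see [in_free]), so that it is a datum only for the tree
   reduced to one leaf. *)
Inductive tree : Type :=
  | Leaf of C
  | Node of P & seq tree.

Definition tree_out (t : tree) : C :=
  match t with Leaf a => a | Node x _ => out x end.

Fixpoint in_free S (t : tree) : Prop :=
  match t with
  | Leaf _ => True
  | Node x ts =>
      [/\ S x, map tree_out ts = inp x
        & foldr (fun t' Q => in_free S t' /\ Q) True ts]
  end.

Fixpoint ev (t : tree) : P :=
  match t with
  | Leaf a => op_unit P a
  | Node x ts => ccomp x (map ev ts)
  end.

Definition finitely_factorizes S : Prop :=
  forall x : P, finite_set [set t : tree | in_free S t /\ ev t = x].

Definition arity_one S : set P := [set x | S x /\ arity x = 1%N].

Section Series.

Variable K : fieldType.
Implicit Types f g : P -> K.

Definition charac S : P -> K := fun x => (x \in S)%:R.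

Definition unit_series : P -> K := charac [set op_unit P a | a in setT].

(* \sum_(i \in A) F i is the sum of the nonzero values of F on A when they are
   finitely many (and 0 otherwise).  Here they are when P is locally finite. *)
Definition cprod f g : P -> K := fun x =>
  \sum_(p \in [set p : P * seq P |
                 ccomposable p.1 p.2 /\ ccomp p.1 p.2 = x])
     (f p.1 * \prod_(z <- p.2) g z).

(* Iterated products are bracketed to the left, here and in [sync]. *)
Definition cpow f (l : nat) : P -> K := iter l (fun g => cprod g f) unit_series.

(* Same convention for the sum; for the series of rules, the nonzero terms are
   finitely many when the ground operad is locally finite and the rules of arity
   one finitely factorize the bud operad. *)
Definition cstar f : P -> K := fun x => \sum_(l \in [set: nat]) cpow f l x.

End Series.

End Operads.

Section Bud.

Variables (C : finType) (O : operad).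

(* The triples (a, x, u), encoded as ((a, x), u). *)
Definition bud_sort : choiceType :=
  {t : C * O * seq C | size t.2 == arity t.1.2}.

Implicit Types b c : bud_sort.

Definition bud_out b : C := (val b).1.1.
Definition bud_elt b : O := (val b).1.2.
Definition bud_inp b : seq C := (val b).2.

Fact bud_unit_subproof (a : C) :
  size [:: a] == arity (op_unit O tt).
Proof. by rewrite /arity inp_unit. Qed.

Definition bud_unit (a : C) : bud_sort :=
  exist _ (a, op_unit O tt, [:: a]) (bud_unit_subproof a).

(* The default value b of [insubd] is reached only outside the positions of
   b, where the composition is not defined. *)
Definition bud_pcomp b (i : nat) c : bud_sort :=
  insubd b (bud_out b, pcomp (bud_elt b) i (bud_elt c),
            subst_at (bud_inp b) i (bud_inp c)).

Lemma size_bud_inp b : size (bud_inp b) = size (inp (bud_elt b)).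
Proof. exact/eqP/(valP b). Qed.

Lemma bud_onth b i a (t : unit) :
  onth (bud_inp b) i = Some a -> onth (inp (bud_elt b)) i = Some t.
Proof.
move=> h; have := onth_lt h; rewrite size_bud_inp -onthTE.
by case: onth => // -[]; case: t.
Qed.

Lemma val_bud_pcomp b i c : onth (bud_inp b) i = Some (bud_out c) ->
  val (bud_pcomp b i c) = (bud_out b, pcomp (bud_elt b) i (bud_elt c),
                           subst_at (bud_inp b) i (bud_inp c)).
Proof.
move=> h; have h' := bud_onth (out (bud_elt c)) h.
rewrite val_insubd ifT //= /arity inp_pcomp //.
by rewrite !size_cat !size_take !size_drop !size_bud_inp.
Qed.

Lemma bud_eqP b c : bud_out b = bud_out c -> bud_elt b = bud_elt c ->
  bud_inp b = bud_inp c -> b = c.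
Proof.
move=> e1 e2 e3; apply: val_inj; move: e1 e2 e3; rewrite /bud_out /bud_elt /bud_inp.
by case: (val b) => [[? ?] ?]; case: (val c) => [[? ?] ?] /= -> -> ->.
Qed.

Lemma bud_inp_neq0 b : bud_inp b != [::].
Proof. by rewrite -size_eq0 size_bud_inp size_eq0 inp_neq0. Qed.

Lemma bud_out_pcomp b i c : onth (bud_inp b) i = Some (bud_out c) ->
  bud_out (bud_pcomp b i c) = bud_out b.
Proof. by move=> h; rewrite {1}/bud_out val_bud_pcomp. Qed.

Lemma bud_elt_pcomp b i c : onth (bud_inp b) i = Some (bud_out c) ->
  bud_elt (bud_pcomp b i c) = pcomp (bud_elt b) i (bud_elt c).
Proof. by move=> h; rewrite {1}/bud_elt val_bud_pcomp. Qed.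

Lemma bud_inp_pcomp b i c : onth (bud_inp b) i = Some (bud_out c) ->
  bud_inp (bud_pcomp b i c) = subst_at (bud_inp b) i (bud_inp c).
Proof. by move=> h; rewrite {1}/bud_inp val_bud_pcomp. Qed.

Lemma bud_pcomp_seqA b i c j d :
  onth (bud_inp b) i = Some (bud_out c) ->
  onth (bud_inp c) j = Some (bud_out d) ->
  bud_pcomp (bud_pcomp b i c) (i + j)%N d = bud_pcomp b i (bud_pcomp c j d).
Proof.
move=> bi cj; have [h1 h2] := subst_at_seqA (bud_inp d) bi cj.
have h3 : onth (bud_inp (bud_pcomp b i c)) (i + j) = Some (bud_out d).
  by rewrite bud_inp_pcomp.
have h4 : onth (bud_inp b) i = Some (bud_out (bud_pcomp c j d)).
  by rewrite bud_out_pcomp.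
apply: bud_eqP; first by rewrite !bud_out_pcomp.
  rewrite !bud_elt_pcomp // pcomp_seqA //.
    exact: bud_onth bi.
  exact: bud_onth cj.
by rewrite !bud_inp_pcomp.
Qed.

Lemma bud_pcomp_parA b i c j d :
  (i < j)%N ->
  onth (bud_inp b) i = Some (bud_out c) ->
  onth (bud_inp b) j = Some (bud_out d) ->
  bud_pcomp (bud_pcomp b i c) (j + size (bud_inp c)).-1 d =
  bud_pcomp (bud_pcomp b j d) i c.
Proof.
move=> ij bi bj.
have [h1 h2 h3] := subst_at_parA (bud_inp c) (bud_inp d) ij bi bj.
have h4 : onth (bud_inp (bud_pcomp b i c)) (j + size (bud_inp c)).-1
    = Some (bud_out d) by rewrite bud_inp_pcomp.
have h5 : onth (bud_inp (bud_pcomp b j d)) i = Some (bud_out c).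
  by rewrite bud_inp_pcomp.
apply: bud_eqP; first by rewrite !bud_out_pcomp.
  rewrite !bud_elt_pcomp // size_bud_inp pcomp_parA //.
    exact: bud_onth bi.
  exact: bud_onth bj.
by rewrite !bud_inp_pcomp.
Qed.

Lemma bud_pcomp1x b : bud_pcomp (bud_unit (bud_out b)) 0 b = b.
Proof.
have h : onth (bud_inp (bud_unit (bud_out b))) 0 = Some (bud_out b) by [].
apply: bud_eqP; first by rewrite bud_out_pcomp.
  rewrite bud_elt_pcomp // -[RHS]pcomp1x; congr (pcomp _ _ _).
  by rewrite /bud_elt /=; case: (out _).
by rewrite bud_inp_pcomp // /subst_at /= cats0.
Qed.

Lemma bud_pcompx1 b i a :
  onth (bud_inp b) i = Some a -> bud_pcomp b i (bud_unit a) = b.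
Proof.
move=> h; apply: bud_eqP; first by rewrite bud_out_pcomp.
  by rewrite bud_elt_pcomp // pcompx1 //; exact: bud_onth h.
rewrite bud_inp_pcomp // -[bud_inp (bud_unit a)]/[:: a].
by have [p [q [-> ->]]] := onth_split h; rewrite subst_at_cat.
Qed.

Definition Bud : colored_operad C :=
  @ColoredOperad C bud_sort bud_out bud_inp bud_unit bud_pcomp
    bud_inp_neq0 (fun=> erefl) (fun=> erefl) bud_out_pcomp bud_inp_pcomp
    bud_pcomp_seqA bud_pcomp_parA bud_pcomp1x bud_pcompx1.

End Bud.

Record bud_generating_system := BudGeneratingSystem {
  colors : finType;
  ground : operad;
  rules : {fset Bud colors ground};
  initial : {set colors};
  terminal : {set colors}
}.

Section GeneratingSystems.

Variables (K : fieldType) (B : bud_generating_system).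

Local Notation budB := (Bud (colors B) (ground B)).

Definition rule_series : budB -> K := charac K [set` rules B].

Definition initial_series : budB -> K :=
  charac K [set op_unit budB a | a in [set` initial B]].

Definition terminal_series : budB -> K :=
  charac K [set op_unit budB a | a in [set` terminal B]].

Definition sync : budB -> K :=
  cprod (cprod initial_series (cstar rule_series)) terminal_series.

Definition synchronously_unambiguous : Prop :=
  forall x : budB, sync x = 0 \/ sync x = 1.

End GeneratingSystems.

Arguments sync K B _ : clear implicits.

Section ColorTypes.

Variable C : finType.

Definition type_of (u : seq C) : {ffun C -> nat} :=
  [ffun c => count_mem c u].

Definition color_type : choiceType :=
  {alpha : {ffun C -> nat} | alpha != [ffun=> 0%N]}.

(* The colors c_1, ..., c_k are enumerated as in [enum C]. *)
Definition word_of (alpha : {ffun C -> nat}) : seq C :=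
  flatten [seq nseq (alpha c) c | c <- enum C].

Definition nonempty_words (T : {set C}) : set (seq C) :=
  [set u | u != [::] /\ all (mem T) u].

(* Monomials in the commuting variables x_c (index inl c) and y_c (index
   inr c), given by their exponents. *)
Definition monomial : choiceType := {ffun C + C -> nat}.

Definition xymon (a : C) (alpha : {ffun C -> nat}) : monomial :=
  [ffun v => match v with inl b => nat_of_bool (b == a) | inr b => alpha b end].

(* K[[X_C U Y_C]]: a series is its function of coefficients. *)
Definition xy_series (K : fieldType) : Type := monomial -> K.

Definition colt (K : fieldType) (P : colored_operad C) (g : P -> K) :
    xy_series K := fun m =>
  \sum_(x \in [set x : P | xymon (out x) (type_of (inp x)) = m]) g x.

End ColorTypes.

Section Phi.

Variable C : finType.

(* The maps phi : C * T_C -> nat with finite support.  Pairs outside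
   [finsupp phi] contribute 0 to the sums and 1 to the products below. *)
Definition phi_map : choiceType :=
  {fsfun C * color_type C -> nat with 0%N}.

Implicit Type phi : phi_map.

(* phi^(a) *)
Definition phi_sup phi (a : C) : nat :=
  (\sum_(p <- finsupp phi) phi p * val p.2 a)%N.

(* \sum phi_a *)
Definition phi_sum phi (a : C) : nat :=
  (\sum_(p <- finsupp phi | p.1 == a) phi p)%N.

(* phi_a! *)
Definition phi_multinomial phi (a : C) : nat :=
  ((phi_sum phi a)`! %/ \prod_(p <- finsupp phi | p.1 == a) (phi p)`!)%N.

End Phi.

Definition chi (B : bud_generating_system) (a : colors B)
    (gamma : color_type (colors B)) : nat :=
  #|` [fset r in rules B | (out r == a) && (type_of (inp r) == val gamma)]|%fset.

Definition phi_weight (B : bud_generating_system) (phi : phi_map (colors B)) :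
    nat :=
  (\prod_(p <- finsupp phi) chi p.1 p.2 ^ phi p)%N.

(* Main.v *)
Require Import Defs.
From mathcomp Require Import all_boot all_order all_algebra finmap.
From mathcomp Require Import mathcomp_extra boolp classical_sets functions.
From mathcomp Require Import cardinality fsbigop.

(** The color types of the powers of the series of rules satisfy, level by level,
the recursion imposed on f; and this recursion determines f, because it strictly
decreases a suitable weight on types.

Let r be the characteristic series of the rules and let s_l be the series of
color types of the l-th power of r for the composition product.  An element of
the bud operad contributes to g (.) r through pairs (y, z), where z is a word of
rules whose word of output colors is the input word of y.  Such a word z has a
profile: the map phi counting its letters by the pairs (output color, type of
the input word).  The type of the word of its output colors and that of the
concatenation of its input words are read off phi as b |-> sum phi_b and
a |-> phi^(a).  Conversely a fixed word of colors of type b |-> sum phi_b is the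
output word of exactly (prod_b phi_b!) (prod chi^phi) words of rules of profile
phi ([profile_countE], [profile_count_phi]).  Hence
  s_(l+1)(a, alpha) = sum_phi (prod_b phi_b!) (prod chi^phi) s_l(a, sum phi),
the sum being over the phi with phi^(.) = alpha ([colt_cprod_rules]), while s_0
is the Kronecker delta ([colt_unit_series]).

Draw an edge from the output color to the input color of each rule of arity one.
By finite factorization this graph on the colors is acyclic: a cycle would give
infinitely many trees evaluating to the finitely many elements of arity one
([acyclic_arity_one]).  Weighing each color by its number of ancestors, plus a
constant larger than the number of colors, one gets w such that w (out r) is
smaller than the sum of w over in r for every rule r ([rule_weight]).  Extend w
linearly to types.  Then l <= w(type (in x)) as soon as x is in the support of
the l-th power of r ([cpow_weight]), so that the iterated sum is finite on each
type, and w(sum phi) < w(phi^(.)) whenever prod chi^phi is nonzero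
([weight_lt]).  By induction on L, any solution f of the recursion satisfies
f(a, alpha) = sum_(l < L) s_l(a, alpha) as soon as w(alpha) < L
([recursion_solution]).

Multiplying on both sides by the series of initial and of terminal units only
restricts the support, and changes no coefficient at the x with output color in
I and input word on T ([sync_cstar]).  Summing over the finitely many x of given
output color and type concludes. *)

Set Implicit Arguments.
Unset Strict Implicit.
Unset Printing Implicit Defensive.

Import GRing.Theory.

Local Open Scope classical_set_scope.
Local Open Scope ring_scope.

(** * Finite sums and words *)

(** A sum over a set, computed on a duplicate-free list that contains all the
indices of nonneutral terms. *)
Lemma fsbig_seq_cond (R : Type) (idx : R) (op : Monoid.com_law idx)
    (T : choiceType) (A : set T) (s : seq T) (P : pred T) (F : T -> R) :
  uniq s -> (forall i, i \in s -> P i -> A i) ->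
  (forall i, A i -> F i <> idx -> (i \in s) && P i) ->
  \big[op/idx]_(i \in A) F i = \big[op/idx]_(i <- s | P i) F i.
Proof.
move=> us sA As; rewrite -[RHS]big_filter [RHS]fsbig_seq ?filter_uniq //.
apply/esym; apply: fsbig_widen => [i /=|i /= [Ai]]; rewrite mem_filter.
  by move=> /andP[Pi si]; apply: sA.
by rewrite andbC => nsi; apply: contrapT => /(As _ Ai).
Qed.

(** The words of length n on the letters of s. *)
Fixpoint words (T : Type) (s : seq T) (n : nat) : seq (seq T) :=
  if n is n'.+1 then [seq x :: w | x <- s, w <- words s n'] else [:: [::]].

Lemma mem_words (T : eqType) (s : seq T) n w :
  (w \in words s n) = (size w == n) && all (mem s) w.
Proof.
elim: n w => [|n IH] w /=; first by rewrite inE -size_eq0; case: w.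
apply/allpairsP/andP => [[[x v] /= [xs vs ->]]|].
  by move: vs; rewrite IH => /andP[/eqP <- av]; split=> //=; apply/andP.
case: w => [|x v] /= [] // /eqP [sv] /andP[xs av].
by exists (x, v); split=> //=; rewrite IH sv eqxx.
Qed.

Lemma words_uniq (T : eqType) (s : seq T) n : uniq s -> uniq (words s n).
Proof.
move=> us; elim: n => //= n IH; apply: allpairs_uniq => //.
by move=> [x v] [y w] _ _ /= [-> ->].
Qed.

(** * Counting words of given profile *)

(** The letters of the alphabet s carry a key, and the keys carry a color. *)

Section WordCount.

Variables (T D C : eqType) (s : seq T) (key : T -> D) (col : D -> C).

(** phi p is the number of letters of w of key p. *)
Definition has_profile (phi : D -> nat) (w : seq T) : bool :=
  `[< forall p, count_mem p (map key w) = phi p >].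

(** The number of words on s of profile phi whose word of colors is u. *)
Definition profile_count (u : seq C) (phi : D -> nat) : nat :=
  (\sum_(w <- words s (size u) |
      (map (col \o key) w == u) && has_profile phi w) 1)%N.

(** The number of letters of key p in the alphabet s. *)
Definition key_mult (p : D) : nat := count (fun x => key x == p) s.

(** The profile phi with one occurrence of p removed. *)
Definition decr (phi : D -> nat) (p : D) : D -> nat :=
  fun q => (phi q - (q == p))%N.

Lemma has_profile_cons phi x w :
  has_profile phi (x :: w) =
  (0 < phi (key x))%N && has_profile (decr phi (key x)) w.
Proof.
apply/asboolP/andP => [h|[h0 /asboolP h] p] /=.
  split; first by rewrite -h /= eqxx.
  by apply/asboolP => p; rewrite /decr -h /= eq_sym addKn.
rewrite h /decr eq_sym; case: eqP => [->|]; last by rewrite subn0.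
by rewrite subnKC.
Qed.

Lemma sum_by_key (Q : pred D) (S : seq D) (F : D -> nat) :
  uniq S -> (forall p, p \notin S -> F p = 0%N) ->
  (\sum_(x <- s | Q (key x)) F (key x) =
   \sum_(p <- S | Q p) key_mult p * F p)%N.
Proof.
move=> uS F0; rewrite /key_mult; elim: s => [|x t IH].
  by rewrite big_nil big1 // => p _; rewrite mul0n.
rewrite big_cons IH.
under [RHS]eq_bigr do rewrite /= mulnDl.
rewrite big_split /=.
have -> : (\sum_(p <- S | Q p) (key x == p) * F p =
           if Q (key x) then F (key x) else 0)%N.
  have [xS|xS] := boolP (key x \in S).
    rewrite big_mkcond (bigD1_seq (key x)) //= eqxx mul1n big1 ?addn0 //.
    by move=> p /negbTE np; rewrite eq_sym np; case: ifP.
  rewrite F0 // if_same big_seq_cond big1 // => p /andP[pS _].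
  by case: eqP => // e; rewrite e pS in xS.
by case: ifP.
Qed.

Lemma profile_count_cons u c phi :
  profile_count (c :: u) phi =
  (\sum_(x <- s | col (key x) == c)
     (if (0 < phi (key x)) then profile_count u (decr phi (key x)) else 0))%N.
Proof.
rewrite /profile_count /= big_mkcond big_allpairs_dep /= [RHS]big_mkcond.
apply: eq_bigr => x _; rewrite -big_mkcond /=.
under eq_bigl do rewrite eqseq_cons has_profile_cons.
case: eqP => _ /=; last by rewrite big1.
case: ltnP => _ //=; rewrite big1 // => w; by rewrite andbF.
Qed.

(** If, for each color c, the values of phi at the keys of color c add up to the
number of occurrences of c in u, then the number of words of profile phi and
color word u is the product of the multinomial coefficients of phi over the
colors, times the product of the key_mult p ^ phi p; otherwise there is no such
word.  Both sides are multiplied by the factorials of the values of phi, to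
avoid divisions.  Removing the first letter, of key p, of a word decreases
phi p, and (phi p)! is phi p times the factorial of the decreased value: the
induction then amounts to summing phi p over the keys p of color c.  The lists S
and cs enumerate keys and colors, and must contain all those in use. *)
Lemma profile_countE (S : seq D) (phi : D -> nat) (u : seq C) (cs : seq C) :
  uniq S -> uniq cs -> {subset u <= cs} ->
  (forall p, p \in S -> col p \in cs) ->
  (forall p, p \notin S -> phi p = 0%N) ->
  (profile_count u phi * \prod_(p <- S) (phi p)`! =
   all (fun c => (\sum_(p <- S | col p == c) phi p)%N == count_mem c u) cs *
   (\prod_(c <- cs) (count_mem c u)`! * \prod_(p <- S) key_mult p ^ phi p))%N.
Proof.
move=> uS ucs ucs' Scs; elim: u phi ucs' => [|c u IH] phi usub S0.
  rewrite /profile_count /= big_cons big_nil /= addn0.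
  rewrite [\prod_(c <- cs) _]big1 // mul1n.
  have -> : has_profile phi [::] = all (fun p => phi p == 0%N) S.
    apply/asboolP/allP => [h p pS|h p]; first by rewrite -h.
    have [/h /eqP->//|/S0->//] := boolP (p \in S).
  have -> : all (fun c => (\sum_(p <- S | col p == c) phi p)%N == 0%N) cs =
            all (fun p => phi p == 0%N) S.
    apply/allP/allP => [h p pS|h c _]; last first.
      by rewrite big_seq_cond big1 // => p /andP[/h/eqP].
    have /eqP := h _ (Scs _ pS).
    by rewrite big_mkcond (bigD1_seq p) //= eqxx => /eqP; rewrite addn_eq0 => /andP[].
  case: allP => [h|_]; last by rewrite !mul0n.
  rewrite !mul1n !big_seq; apply: eq_bigr => p /h /eqP ->.
  by rewrite expn0.
have subu : {subset u <= cs} by move=> x xu; apply: usub; rewrite inE xu orbT.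
have cc : c \in cs by apply: usub; rewrite mem_head.
rewrite profile_count_cons (sum_by_key (fun p => col p == c)
  (F := fun p => if (0 < phi p)%N then profile_count u (decr phi p) else 0%N)
  uS); last by move=> p /S0 ->.
rewrite big_distrl /=.
set H := (all (fun c' => (\sum_(p <- S | col p == c') phi p)%N ==
                         count_mem c' (c :: u)) cs *
          (\prod_(c' <- cs) (count_mem c' u)`! *
           \prod_(p <- S) key_mult p ^ phi p))%N.
(* The words beginning with a letter of key p. *)
have key_term p : p \in S -> col p == c ->
  (key_mult p * (if 0 < phi p then profile_count u (decr phi p) else 0) *
   \prod_(q <- S) (phi q)`! = phi p * H)%N.
  move=> pS /eqP pc; case: ltnP => [phi0|]; last first.
    by rewrite leqn0 => /eqP->; rewrite muln0.
  have -> : (\prod_(q <- S) (phi q)`! =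
             phi p * \prod_(q <- S) (decr phi p q)`!)%N.
    rewrite !(bigD1_seq p) //= /decr eqxx subn1 mulnA; congr (_ * _)%N.
      by case: (phi p) phi0.
    by apply: eq_bigr => q /negbTE ->; rewrite subn0.
  rewrite mulnCA -mulnA IH //; last by move=> q /S0; rewrite /decr => ->.
  congr (_ * _)%N; rewrite mulnCA /H; congr (nat_of_bool _ * _)%N; last first.
    rewrite mulnCA; congr (_ * _)%N.
    rewrite !(bigD1_seq p pS) //= mulnA /decr eqxx subn1 -expnS prednK //.
    by congr (_ * _)%N; apply: eq_bigr => q /negbTE ->; rewrite subn0.
  apply: eq_all => b /=.
  have -> : (\sum_(q <- S | col q == b) phi q =
             (c == b) + \sum_(q <- S | col q == b) decr phi p q)%N.
    have phiE q : phi q = ((q == p) + decr phi p q)%N.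
      by rewrite /decr; case: eqP => [->|]; rewrite ?subn0 // subnKC.
    under eq_bigr do rewrite phiE; rewrite big_split /=; congr (_ + _)%N.
    rewrite big_mkcond (bigD1_seq p) //= pc eqxx big1 ?addn0; first by case: eqP.
    by move=> q /negbTE ->; rewrite if_same.
  by rewrite eqn_add2l.
rewrite big_seq_cond; under eq_bigr => p /andP[pS pc] do rewrite key_term //.
rewrite -big_seq_cond -big_distrl /= /H mulnCA.
case: allP => [h|_]; last by rewrite !mul0n.
rewrite !mul1n mulnA; congr (_ * _)%N.
rewrite (eqP (h _ cc)) /= eqxx !(bigD1_seq c cc) //= eqxx mulnA.
congr (_ * _)%N; apply: eq_bigr => b /negbTE bc.
by rewrite eq_sym bc.
Qed.

End WordCount.

Lemma prod_fact_dvdn (I : Type) (r : seq I) (P : pred I) (F : I -> nat) :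
  (\prod_(i <- r | P i) (F i)`! %| (\sum_(i <- r | P i) F i)`!)%N.
Proof.
apply: (big_rec2 (fun m n => m %| n`!)%N) => // i m n _ mn.
rewrite -(bin_fact (leq_addr n (F i))) addKn dvdn_mull // dvdn_mul //.
Qed.

(** * Composition products in colored operads *)

Section Composition.

Variables (C : finType) (P : colored_operad C).
Implicit Types (x y z : P) (ys : seq P).

(** The partially computed complete composition: the inputs in u are still those
of x, the next ones have been substituted. *)
Lemma ccomp_from_out_inp (u : seq C) x ys : inp x = u ++ map (@out C P) ys ->
  out (ccomp_from (size u) x ys) = out x /\
  inp (ccomp_from (size u) x ys) = u ++ flatten (map (@inp C P) ys).
Proof.
elim: ys u => [|y ys IH] u //= xE.
have [|o i] := IH (rcons u (out y)); first by rewrite cat_rcons.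
rewrite size_rcons in o i.
have uy : onth (inp (ccomp_from (size u).+1 x ys)) (size u) = Some (out y).
  by rewrite i cat_rcons onth_size_cat.
by rewrite out_pcomp // inp_pcomp // i cat_rcons subst_at_cat.
Qed.

Lemma out_ccomp x ys : ccomposable x ys -> out (ccomp x ys) = out x.
Proof. by move=> /esym /(@ccomp_from_out_inp [::]) []. Qed.

Lemma inp_ccomp x ys :
  ccomposable x ys -> inp (ccomp x ys) = flatten (map (@inp C P) ys).
Proof. by move=> /esym /(@ccomp_from_out_inp [::]) []. Qed.

Lemma ccomp1x x : ccomp (op_unit P (out x)) [:: x] = x.
Proof. exact: pcomp1x. Qed.

Lemma ccompx1 x : ccomp x (map (op_unit P) (inp x)) = x.
Proof.
suff h u v : inp x = u ++ v -> ccomp_from (size u) x (map (op_unit P) v) = x.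
  exact: (h [::]).
elim: v u => //= c v IH u xE; rewrite -(size_rcons u c) IH ?cat_rcons //.
by rewrite pcompx1 // xE onth_size_cat.
Qed.

Lemma ccomposable_size x ys : ccomposable x ys -> size ys = size (inp x).
Proof. by move=> <-; rewrite size_map. Qed.

Lemma arity_gt0 x : (0 < arity x)%N.
Proof. by rewrite lt0n size_eq0 inp_neq0. Qed.

Lemma arity_ccomp_ge x ys : ccomposable x ys -> (arity x <= arity (ccomp x ys))%N.
Proof.
move=> xys; rewrite /arity inp_ccomp // -(ccomposable_size xys).
elim: ys {xys} => //= y ys IH; rewrite size_cat -add1n leq_add //.
exact: arity_gt0.
Qed.

Variable K : fieldType.
Implicit Types (f g : P -> K) (S : set P).

Lemma characE S x : charac K S x != 0 -> S x.
Proof. by rewrite /charac; have [/set_mem//|] := boolP (x \in S); rewrite eqxx. Qed.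

Lemma charac_in S x : S x -> charac K S x = 1.
Proof. by move=> Sx; rewrite /charac mem_set. Qed.

Lemma prod_charac_neq0 S ys : \prod_(z <- ys) charac K S z != 0 ->
  forall z, z \in ys -> S z.
Proof.
rewrite prodf_seq_neq0 => /allP h z zys; exact: characE (h _ zys).
Qed.

Lemma cprod_neq0 f g x : cprod f g x != 0 -> exists y zs,
  [/\ ccomposable y zs, ccomp y zs = x, f y != 0 & \prod_(z <- zs) g z != 0].
Proof.
apply: contra_neqP => h; apply: fsbig1 => -[y zs] /= [yzs yx].
apply: contra_notP h => /eqP; rewrite mulf_eq0 negb_or => /andP[fy gzs].
by exists y, zs.
Qed.

Lemma cprod_units_l (A : set C) g x : A (out x) ->
  cprod (charac K [set op_unit P a | a in A]) g x = g x.
Proof.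
move=> Ax; rewrite /cprod.
rewrite (@fsbig_seq_cond _ _ _ _ _ [:: (op_unit P (out x), [:: x])] xpredT) //.
- rewrite big_seq1 /= big_seq1 charac_in ?mul1r //; by exists (out x).
- move=> i; rewrite inE => /eqP -> _ /=.
  by rewrite /ccomposable inp_unit ccomp1x.
- move=> [y zs] /= [yzs yx] /eqP; rewrite mulf_eq0 negb_or => /andP[].
  move=> /characE [a Aa ya] _; subst y; move: yzs yx.
  rewrite /ccomposable inp_unit; case: zs => [|z []] //= [<-].
  by rewrite ccomp1x => ->; rewrite inE eqxx.
Qed.

Lemma cprod_units_r (A : set C) g x : (forall c, c \in inp x -> A c) ->
  cprod g (charac K [set op_unit P a | a in A]) x = g x.
Proof.
move=> Ax; rewrite /cprod.
rewrite (@fsbig_seq_cond _ _ _ _ _ [:: (x, map (op_unit P) (inp x))] xpredT) //.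
- rewrite big_seq1 /= big_map big_seq big1 ?mulr1 // => c cx.
  by rewrite charac_in //; exists c => //; apply: Ax.
- move=> i; rewrite inE => /eqP -> _ /=; split; last exact: ccompx1.
  by rewrite /ccomposable -map_comp map_id_in // => c _ /=; rewrite out_unit.
- move=> [y zs] /= [yzs yx] /eqP; rewrite mulf_eq0 negb_or => /andP[_].
  move=> /prod_charac_neq0 zsU.
  have zsE : zs = map (op_unit P) (inp y).
    rewrite -yzs -map_comp -[LHS]map_id; apply/eq_in_map => z /zsU [a _ <-] /=.
    by rewrite out_unit.
  by rewrite -yx zsE ccompx1 inE eqxx.
Qed.

End Composition.

(** * Weights increased by the rules *)

Section Weights.

Variables (C : finType) (P : colored_operad C).
Hypothesis lfP : locally_finite P.

(** The number of internal nodes on the leftmost branch of a tree. *)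
Fixpoint spine (t : tree P) : nat :=
  if t is Node _ ts then (if ts is t' :: _ then spine t' else 0%N).+1 else 0%N.

(** A path in the graph of the elements of arity one in S, read as a tree with a
single branch. *)
Lemma path_tree (S : set P) (e : rel C) :
  (forall b c, e b c -> exists r, [/\ S r, out r = b & inp r = [:: c]]) ->
  forall c p, path e c p -> exists t : tree P,
    [/\ in_free (arity_one S) t, tree_out t = c, spine t = size p,
        out (ev t) = c & arity (ev t) = 1%N].
Proof.
move=> eS c p; elim: p c => [|d p IH] c /=.
  by exists (Leaf P c); rewrite /arity /= out_unit inp_unit.
case/andP=> /eS [r [Sr ro ri]] /IH [t [ft ot st ou ar]].
have rt : ccomposable r [:: ev t] by rewrite /ccomposable /= ou ri.
exists (Node r [:: t]); split => //=.
- by rewrite ot ri; split=> //; split=> //; rewrite /arity ri.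
- by rewrite st.
- by rewrite out_ccomp.
- by rewrite /arity inp_ccomp //= cats0.
Qed.

(** A cycle would give trees with arbitrarily long branches that evaluate to the
finitely many elements of arity one. *)
Lemma acyclic_arity_one (S : set P) (e : rel C) :
  finitely_factorizes (arity_one S) ->
  (forall b c, e b c -> exists r, [/\ S r, out r = b & inp r = [:: c]]) ->
  forall b c, e b c -> ~~ connect e c b.
Proof.
move=> ff eS b c ebc; apply/negP => /connectP [p ep bE].
have cyc m : path e b (flatten (nseq m (c :: p))).
  elim: m => //= m IH; rewrite ebc cat_path ep -bE; exact: IH.
pose X := \bigcup_(x in [set x : P | arity x = 1%N])
  [set t : tree P | in_free (arity_one S) t /\ ev t = x].
have finX : finite_set (spine @` X).
  by apply: finite_image; apply: bigcup_finite => // x _; apply: ff.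
have /finite_seqP [s sE] := finX.
have := cyc (\max_(i <- s) i).+1 => /(path_tree eS) [t [ft _ st _ ar]].
have : [set` s] (spine t) by rewrite -sE; exists t => //; exists (ev t).
rewrite /= => ts; have := @leq_bigmax_seq _ s xpredT id _ ts isT.
rewrite st size_flatten /shape map_nseq sumn_nseq leqNgt.
by rewrite leq_pmull.
Qed.

Lemma rule_weight (S : set P) : finitely_factorizes (arity_one S) ->
  exists w : C -> nat,
    forall r, S r -> (w (out r) < \sum_(c <- inp r) w c)%N.
Proof.
move=> ff.
pose e : rel C := fun b c => `[< exists r, [/\ S r, out r = b & inp r = [:: c]] >].
have eS b c : e b c -> exists r, [/\ S r, out r = b & inp r = [:: c]].
  by move/asboolP.
(* The number of ancestors strictly increases along an edge. *)
pose d c := #|[pred b | connect e b c]|.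
have dle c : (d c <= #|C|)%N by apply: max_card.
(* With the constant #|C|.+1, two input colors outweigh any output color, since
   ancestors are at most #|C|. *)
exists (fun c => #|C|.+1 + d c)%N => r Sr.
have := inp_neq0 r; case ri: (inp r) => [//|c [|c' u]] _; last first.
  rewrite !big_cons; apply: (@leq_trans (#|C|.+1 + #|C|.+1)%N).
    by rewrite ltn_add2l ltnS.
  by rewrite leq_add ?leq_addr // -addnA leq_addr.
rewrite big_seq1 ltn_add2l; apply: proper_card.
have erc : e (out r) c by apply/asboolP; exists r.
apply/properP; split; first apply/fintype.subsetP => b.
  by rewrite !inE => h; apply: connect_trans h (connect1 erc).
by exists c; rewrite inE ?connect0 //; apply: acyclic_arity_one ff eS _ _ erc.
Qed.

(** Each new factor of the power increases the weight of the input word by at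
least one, since at least one element of S is grafted. *)
Lemma cpow_weight (K : fieldType) (S : set P) (w : C -> nat) :
  (forall r, S r -> (w (out r) < \sum_(c <- inp r) w c)%N) ->
  forall l x, cpow (charac K S) l x != 0 ->
    (w (out x) + l <= \sum_(c <- inp x) w c)%N.
Proof.
move=> wS; elim=> [|l IH] x.
  by move=> /characE [a _ <-]; rewrite out_unit inp_unit big_seq1 addn0.
move=> /cprod_neq0 [y [zs [yzs <- /IH yl /prod_charac_neq0 zsS]]].
rewrite out_ccomp // inp_ccomp // big_flatten big_map addnS.
apply: (@leq_ltn_trans (\sum_(z <- zs) w (out z))%N).
  by move: yl; rewrite -[in X in (_ <= X)%N]yzs big_map.
have : zs != [::].
  by rewrite -size_eq0 (ccomposable_size yzs) size_eq0 inp_neq0.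
case: zs zsS {yzs} => // z zs zsS _; rewrite !big_cons -addSn leq_add //.
  by apply: wS; apply: zsS; rewrite mem_head.
rewrite big_seq [X in (_ <= X)%N]big_seq; apply: leq_sum => z' z's.
by apply/ltnW/wS/zsS; rewrite inE z's orbT.
Qed.

End Weights.

(** * Bud operads *)

Lemma bud_locally_finite (C : finType) (O : operad) :
  locally_finite O -> locally_finite (Bud C O).
Proof.
move=> lfO n.
pose X := ([set: C] `*` [set x : O | arity x = n]) `*` [set` words (enum C) n].
have finX : finite_set X.
  by do !apply: finite_setX => //; apply: finite_finset.
apply: (@sub_finite_set _ _ (val @^-1` X)); last first.
  by apply: finite_preimage finX => x y _ _; apply: val_inj.
move=> x /= xn; split; last first.
  rewrite /= mem_words -[size _]/(arity (x : Bud C O)) xn eqxx /=.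
  by apply/allP => c _; rewrite inE mem_enum.
split=> //=; rewrite -xn; exact/esym/eqP/(valP x).
Qed.

(** * Types and the sums attached to a map phi *)

Section Types.

Variable C : finType.
Implicit Types (u : seq C) (alpha : {ffun C -> nat}) (phi : phi_map C).

Lemma sum_count_mem (w : C -> nat) u :
  (\sum_c count_mem c u * w c = \sum_(c <- u) w c)%N.
Proof.
elim: u => [|b u IH]; first by rewrite big_nil big1 // => c _; rewrite mul0n.
under eq_bigr do rewrite /= mulnDl.
rewrite big_split /= IH big_cons (bigD1 b) //= eqxx mul1n big1 ?addn0 //.
by move=> c /negbTE; rewrite eq_sym => ->.
Qed.

(** The degree of a type, that is, the length of the words of that type. *)
Definition degree alpha : nat := (\sum_c alpha c)%N.

Lemma degree_type_of u : degree (type_of u) = size u.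
Proof.
rewrite -sum1_size -sum_count_mem; apply: eq_bigr => c _.
by rewrite ffunE muln1.
Qed.

Lemma type_of_word_of alpha : type_of (word_of alpha) = alpha.
Proof.
apply/ffunP => c; rewrite ffunE count_flatten sumnE !big_map -enumT.
rewrite big_enum /= (bigD1 c) //= count_nseq /= eqxx mul1n big1 ?addn0 //.
by move=> b /negbTE bc; rewrite count_nseq /= bc.
Qed.

Lemma type_of_neq0 u : u != [::] -> type_of u != [ffun=> 0%N].
Proof.
rewrite -size_eq0 -degree_type_of; apply: contraNneq => ->.
by rewrite /degree big1 // => c _; rewrite ffunE.
Qed.

Lemma xymon_eq (a b : C) alpha beta :
  (xymon a alpha == xymon b beta) = (a == b) && (alpha == beta).
Proof.
apply/eqP/andP => [e|[/eqP-> /eqP->]//]; split; apply/eqP.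
  by have /ffunP/(_ (inl a)) := e; rewrite !ffunE eqxx; case: eqP.
by apply/ffunP => c; have /ffunP/(_ (inr c)) := e; rewrite !ffunE.
Qed.

(** The type with components sum phi_b. *)
Definition phi_sums phi : {ffun C -> nat} := [ffun b => phi_sum phi b].

(** The type with components phi^(c). *)
Definition phi_sups phi : {ffun C -> nat} := [ffun c => phi_sup phi c].

Lemma weight_phi_sums phi (w : C -> nat) :
  (\sum_b phi_sums phi b * w b = \sum_(p <- finsupp phi) phi p * w p.1)%N.
Proof.
under eq_bigr do rewrite ffunE /phi_sum big_distrl /= big_mkcond.
rewrite exchange_big; apply: eq_bigr => p _ /=.
rewrite (bigD1 p.1) //= eqxx big1 ?addn0 // => b.
by rewrite eq_sym => /negbTE ->.
Qed.

Lemma weight_phi_sups phi (w : C -> nat) :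
  (\sum_c phi_sups phi c * w c =
   \sum_(p <- finsupp phi) phi p * \sum_c val p.2 c * w c)%N.
Proof.
under eq_bigr do rewrite ffunE /phi_sup big_distrl /=.
rewrite exchange_big; apply: eq_bigr => p _ /=.
by rewrite big_distrr /=; apply: eq_bigr => c _; rewrite mulnA.
Qed.

Lemma color_type_degree_gt0 (gamma : color_type C) : (0 < degree (val gamma))%N.
Proof.
rewrite lt0n; apply: contra (valP gamma); rewrite sum_nat_eq0 => /forallP h.
by apply/eqP/ffunP => c; rewrite ffunE; apply/eqP/h.
Qed.

Lemma degree_phi_sums phi : (degree (phi_sums phi) <= degree (phi_sups phi))%N.
Proof.
have degE alpha : degree alpha = (\sum_c alpha c * 1)%N.
  by apply: eq_bigr => c _; rewrite muln1.
rewrite !degE weight_phi_sums weight_phi_sups.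
apply: leq_sum => p _; rewrite leq_mul2l -degE color_type_degree_gt0.
by rewrite orbT.
Qed.

Lemma phi_sums_neq0 phi : phi_sups phi != [ffun=> 0%N] ->
  phi_sums phi != [ffun=> 0%N].
Proof.
apply: contraNneq => s0.
suff s b gamma : phi (b, gamma) = 0%N.
  apply/eqP/ffunP => c; rewrite !ffunE /phi_sup big1 // => -[b gamma] _.
  by rewrite s.
apply/eqP; have [|/fsfun_dflt->//] := boolP ((b, gamma) \in finsupp phi).
move=> bgS; have /ffunP/(_ b) := s0; rewrite !ffunE /phi_sum big_mkcond.
rewrite (bigD1_seq (b, gamma)) ?fset_uniq //= eqxx.
by move/eqP; rewrite addn_eq0 => /andP[].
Qed.

Lemma prod_phi_multinomial phi :
  (\prod_b phi_multinomial phi b * \prod_(p <- finsupp phi) (phi p)`! =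
   \prod_b (phi_sum phi b)`!)%N.
Proof.
rewrite [(\prod_(p <- finsupp phi) _)%N](partition_big (fun p => p.1) xpredT) //=.
rewrite -big_split; apply: eq_bigr => b _ /=.
by rewrite divnK // prod_fact_dvdn.
Qed.

End Types.

(** * Profiles of words of rules *)

Section Rules.

Variable B : bud_generating_system.
Local Notation C := (colors B).
Local Notation budB := (Bud (colors B) (ground B)).
Implicit Types (r x y : budB) (w : seq budB) (phi : phi_map C).

(** The pair formed by the output color and the input type. *)
Definition rule_key r : C * color_type C :=
  (out r, exist _ (type_of (inp r)) (type_of_neq0 (inp_neq0 r))).

Lemma chiE p : chi p.1 p.2 = key_mult (rules B) rule_key p.
Proof.
case: p => b gamma; rewrite /chi /key_mult -size_filter.
apply/perm_size/uniq_perm.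
- exact: fset_uniq.
- by rewrite filter_uniq // fset_uniq.
move=> r; rewrite !inE mem_filter /= andbC /rule_key.
by rewrite xpair_eqE -val_eqE.
Qed.

(** The profile of a word, as a finitely supported map. *)
Definition profile w : phi_map C :=
  [fsfun p in [fset p in map rule_key w]%fset => count_mem p (map rule_key w)].

Lemma profileE w p : profile w p = count_mem p (map rule_key w).
Proof.
rewrite fsfunE inE; case: ifP => // /negbT /count_memPn.
by move->.
Qed.

Lemma has_profileE phi w : has_profile rule_key phi w = (profile w == phi).
Proof.
apply/asboolP/eqP => [h|<- p]; last by rewrite profileE.
by apply/fsfunP => p; rewrite profileE h.
Qed.

Lemma sum_profile (G : C * color_type C -> nat) w :
  (\sum_(p <- finsupp (profile w)) profile w p * G p =
   \sum_(r <- w) G (rule_key r))%N.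
Proof.
rewrite -[RHS](big_map rule_key xpredT) -[RHS]big_undup_iterop_count.
rewrite [RHS](perm_big (finsupp (profile w))); last first.
  apply: uniq_perm; rewrite ?undup_uniq ?fset_uniq // => p.
  by rewrite mem_undup mem_finsupp profileE -has_pred1 has_count lt0n.
apply: eq_bigr => p _; rewrite profileE; case: count => // n.
by rewrite Monoid.iteropE iter_addn addn0 mulnC.
Qed.

Lemma phi_sups_profile w :
  phi_sups (profile w) = type_of (flatten (map (@inp C budB) w)).
Proof.
apply/ffunP => c; rewrite !ffunE /phi_sup (sum_profile (fun p => val p.2 c)).
rewrite count_flatten sumnE !big_map.
by apply: eq_bigr => r _; rewrite /= ffunE.
Qed.

(** The coefficients of the recursion count words of rules. *)
Lemma profile_count_phi phi (u : seq C) :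
  profile_count (rules B) rule_key fst u phi =
  ((type_of u == phi_sums phi) *
   (\prod_b phi_multinomial phi b * phi_weight phi))%N.
Proof.
have phi_gt0 : (0 < \prod_(p <- finsupp phi) (phi p)`!)%N.
  by rewrite prodn_gt0 // => p; rewrite fact_gt0.
apply/eqP; rewrite -(eqn_pmul2r phi_gt0); apply/eqP.
rewrite (@profile_countE _ _ _ _ _ fst (finsupp phi) phi u (enum C)).
- have -> : all (fun c => (\sum_(p <- finsupp phi | p.1 == c) phi p)%N ==
                          count_mem c u) (enum C) = (type_of u == phi_sums phi).
    apply/allP/eqP => [h|uE c _]; last first.
      by have /ffunP/(_ c) := uE; rewrite !ffunE => ->; apply: eqxx.
    by apply/ffunP => c; rewrite !ffunE; apply/esym/eqP/h; rewrite mem_enum.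
  case: eqP => [uE|_]; last by rewrite !mul0n.
  rewrite !mul1n mulnAC prod_phi_multinomial big_enum /=; congr (_ * _)%N.
    apply: eq_bigr => b _; have /ffunP/(_ b) := uE; by rewrite !ffunE => ->.
  by apply: eq_bigr => p _; rewrite chiE.
- exact: fset_uniq.
- exact: enum_uniq.
- by move=> c _; rewrite mem_enum.
- by move=> p _; rewrite mem_enum.
- by move=> p; apply: fsfun_dflt.
Qed.

(** The profiles of the words of rules of length at most n.  They
include all the maps of nonzero weight in the recursion in degree at most n. *)
Definition phis (n : nat) : seq (phi_map C) :=
  undup (flatten [seq map profile (words (rules B) k) | k <- iota 0 n.+1]).

Lemma profile_phis n w : (size w <= n)%N -> w \in words (rules B) (size w) ->
  profile w \in phis n.
Proof.
move=> wn ww; rewrite mem_undup; apply/flattenP.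
exists (map profile (words (rules B) (size w))); last exact: map_f.
by apply/mapP; exists (size w); rewrite ?mem_iota.
Qed.

(** A nonzero weight makes the number of words of profile phi and of a suitable
color word nonzero, so that phi is the profile of some word. *)
Lemma mem_phis n phi : (degree (phi_sums phi) <= n)%N ->
  phi_weight phi != 0%N -> phi \in phis n.
Proof.
move=> dn w0; pose u := word_of (phi_sums phi).
have su : size u = degree (phi_sums phi) by rewrite -degree_type_of type_of_word_of.
have := profile_count_phi phi u; rewrite type_of_word_of eqxx mul1n => pc.
have : profile_count (rules B) rule_key fst u phi != 0%N.
  rewrite pc muln_eq0 negb_or w0 andbT.
  apply/eqP => m0; have /esym/eqP := prod_phi_multinomial phi.
  by rewrite m0 mul0n -leqn0 leqNgt prodn_gt0 // => b; rewrite fact_gt0.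
rewrite /profile_count sum_nat_seq_neq0 => /hasP [w ww /andP[/andP[_]]].
rewrite has_profileE => /eqP <- _.
have sw : size w = size u by move: ww; rewrite mem_words => /andP[/eqP].
by apply: profile_phis; rewrite sw // su.
Qed.

(** Each pair in the support of phi is the key of some rule, to which the
hypothesis on w applies; the support is nonempty. *)
Lemma weight_lt phi (w : C -> nat) :
  (forall r, r \in rules B -> (w (out r) < \sum_(c <- inp r) w c)%N) ->
  phi_weight phi != 0%N -> phi_sups phi != [ffun=> 0%N] ->
  (\sum_b phi_sums phi b * w b < \sum_c phi_sups phi c * w c)%N.
Proof.
move=> wR; rewrite /phi_weight prod_nat_seq_neq0 => /allP chi0 s0.
rewrite weight_phi_sums weight_phi_sups.
have lt p : p \in finsupp phi -> (phi p * w p.1 < phi p * \sum_c val p.2 c * w c)%N.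
  move=> pS; have phi0 : (0 < phi p)%N by rewrite lt0n -mem_finsupp.
  rewrite ltn_pmul2l //; have := chi0 _ pS.
  rewrite expn_eq0 phi0 andbT chiE -lt0n -has_count => /hasP [r rR /eqP <-] /=.
  under eq_bigr do rewrite ffunE; rewrite sum_count_mem; exact: wR.
case: (finsupp phi =P fset0) => [S0|/eqP/fset0Pn [q qS]].
  case/eqP: s0; apply/ffunP => c; rewrite !ffunE /phi_sup S0.
  by rewrite big_seq_fset0.
rewrite !(bigD1_seq q) ?fset_uniq //= -addSn leq_add ?lt //.
rewrite big_seq_cond [X in (_ <= X)%N]big_seq_cond.
by apply: leq_sum => p /andP[pS _]; apply/ltnW/lt.
Qed.

End Rules.

(** * The recursion for the series of color types *)

Lemma colt_unit_series (K : fieldType) (C : finType) (P : colored_operad C)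
    (a : C) (alpha : {ffun C -> nat}) :
  colt (@unit_series C P K) (xymon a alpha) = (alpha == type_of [:: a])%:R.
Proof.
rewrite /colt (@fsbig_seq_cond _ _ _ _ _ [:: op_unit P a]
  (fun x => type_of (inp x) == alpha)) //.
- rewrite big_mkcond big_seq1 inp_unit eq_sym /unit_series.
  by case: eqP => // _; rewrite charac_in //; exists a.
- by move=> x; rewrite inE => /eqP -> /eqP <- /=; rewrite out_unit.
- move=> x /= /eqP; rewrite xymon_eq => /andP[/eqP <- ->] /eqP /characE.
  by move=> [b _ <-]; rewrite out_unit inE eqxx.
Qed.

Section Recursion.

Variables (K : fieldType) (B : bud_generating_system).
Local Notation C := (colors B).
Local Notation budB := (Bud (colors B) (ground B)).
Local Notation rB := (rule_series K (B := B)).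
Hypothesis lfO : locally_finite (ground B).
Implicit Types (x y : budB) (g : budB -> K) (alpha : {ffun C -> nat}).

(** The elements of arity at most n. *)
Definition ball (n : nat) : seq budB :=
  fset_set [set x : budB | (arity x <= n)%N].

Lemma mem_ball n x : (x \in ball n) = (arity x <= n)%N.
Proof.
rewrite in_fset_set; first by apply/idP/idP; rewrite inE.
have -> : [set x : budB | (arity x <= n)%N] =
    \bigcup_(k in `I_n.+1) [set x : budB | arity x = k].
  apply/seteqP; split=> [z /= zn|z [k /= kn /= ->] //].
  by exists (arity z).
by apply: bigcup_finite => // k _; apply: bud_locally_finite.
Qed.

Lemma ball_uniq n : uniq (ball n).
Proof. exact: fset_uniq. Qed.

Lemma colt_ball g n a alpha : (degree alpha <= n)%N ->
  colt g (xymon a alpha) =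
  \sum_(x <- ball n | (out x == a) && (type_of (inp x) == alpha)) g x.
Proof.
move=> dn; rewrite /colt; apply: fsbig_seq_cond; first exact: ball_uniq.
  by move=> x _ /=; rewrite -xymon_eq => /eqP.
move=> x /= /eqP; rewrite xymon_eq => /[dup] /andP[_ /eqP xa] -> _.
by rewrite mem_ball andbT /arity -degree_type_of xa.
Qed.

(** In x = y o [w] no arity exceeds that of x, so that the composition product is
a sum over an explicit finite set of pairs (y, w). *)
Lemma cprod_rules_ball g n x : (arity x <= n)%N ->
  cprod g rB x =
  \sum_(y <- ball n) \sum_(w <- words (rules B) (size (inp y)) |
    (map (@out C budB) w == inp y) && (ccomp y w == x)) g y.
Proof.
move=> xn; pose s :=
  [seq (y, w) | y <- ball n, w <- words (rules B) (size (inp y))].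
rewrite /cprod (@fsbig_seq_cond _ _ _ _ _ s
  (fun p => (map (@out C budB) p.2 == inp p.1) && (ccomp p.1 p.2 == x))).
- rewrite big_mkcond big_allpairs_dep; apply: eq_bigr => y _ /=.
  rewrite -big_mkcond; rewrite big_seq_cond [RHS]big_seq_cond.
  apply: eq_bigr => w /andP[+ _]; rewrite mem_words => /andP[_ /allP wR].
  by rewrite big_seq big1 ?mulr1 // => z /wR zR; rewrite /rule_series charac_in.
- apply: allpairs_uniq_dep => [|y _|[y w] [z v] _ _ /= [-> ->] //].
    exact: ball_uniq.
  exact/words_uniq/fset_uniq.
- by move=> [y w] _ /= /andP[/eqP ? /eqP].
- move=> [y w] /= [yw yx] /eqP; rewrite mulf_eq0 negb_or => /andP[_].
  move=> /(@prod_charac_neq0 _ budB) wR.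
  rewrite yx (_ : map _ w = inp y) // !eqxx /= andbT.
  apply/allpairsPdep; exists y, w; split=> //.
    by rewrite mem_ball; apply: leq_trans xn; rewrite -yx arity_ccomp_ge.
  by rewrite mem_words (ccomposable_size yw) eqxx; apply/allP => z /wR.
Qed.

(** The input type of a word of rules only depends on its profile. *)
Lemma sum_words_by_profile n alpha (u : seq C) : (size u <= n)%N ->
  (\sum_(w <- words (rules B) (size u) | (map (@out C budB) w == u) &&
     (type_of (flatten (map (@inp C budB) w)) == alpha)) 1 =
   \sum_(phi <- phis B n | phi_sups phi == alpha)
     profile_count (rules B) (@rule_key B) fst u phi)%N.
Proof.
move=> un; rewrite /profile_count.
rewrite (exchange_big_dep (fun w => map (@out C budB) w == u)) /=; last first.
  by move=> phi w _ /andP[].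
rewrite big_mkcondr big_seq_cond [RHS]big_seq_cond.
apply: eq_bigr => w /andP[ww /eqP wu].
under eq_bigl => phi do
  rewrite -[map _ w]/(map (@out C budB) w) wu eqxx has_profileE.
rewrite -phi_sups_profile.
have sw : size w = size u by rewrite -wu size_map.
have wphi : profile w \in phis B n by apply: profile_phis; rewrite sw.
rewrite big_mkcond (bigD1_seq _ wphi) ?undup_uniq //= eqxx andbT.
rewrite big1 ?addn0 // => phi /negbTE nphi.
by rewrite [profile w == _]eq_sym nphi andbF.
Qed.

(** The recursion, for an arbitrary series g.  Any n bounding the degree of alpha
will do. *)
Lemma colt_cprod_rules g n a alpha : (degree alpha <= n)%N ->
  colt (cprod g rB) (xymon a alpha) =
  \sum_(phi <- phis B n | phi_sups phi == alpha)
    (\prod_b phi_multinomial phi b)%N%:R * (phi_weight phi)%:R *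
    colt g (xymon a (phi_sums phi)).
Proof.
move=> dn; rewrite (colt_ball _ _ dn).
pose Q y (w : seq budB) := (out y == a) &&
  (type_of (flatten (map (@inp C budB) w)) == alpha).
(* A pair (y, w) determines x, which has output color a and type alpha exactly
   when Q y w holds. *)
transitivity (\sum_(y <- ball n) \sum_(w <- words (rules B) (size (inp y)) |
    map (@out C budB) w == inp y) (if Q y w then g y else 0)).
  rewrite big_seq_cond.
  under eq_bigr => x /andP[xn _] do rewrite (@cprod_rules_ball _ n) -?mem_ball //.
  rewrite -big_seq_cond exchange_big /=; apply: eq_bigr => y _.
  rewrite (exchange_big_dep (fun w => map (@out C budB) w == @inp C budB y)) /=;
    last first.
    by move=> x w _ /andP[].
  apply: eq_bigr => w /eqP yw; rewrite yw eqxx /=.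
  have QE : Q y w = (out (@ccomp C budB y w) == a) &&
      (type_of (inp (@ccomp C budB y w)) == alpha).
    by rewrite out_ccomp // inp_ccomp.
  have [Qyw|nQ] := boolP (Q y w); last first.
    rewrite big1 // => x /andP[Qx /eqP xE].
    by move: nQ; rewrite QE xE Qx.
  have xn : (@ccomp C budB y w) \in ball n.
    rewrite mem_ball /arity -degree_type_of.
    by move: Qyw; rewrite QE => /andP[_ /eqP ->].
  rewrite big_mkcond (bigD1_seq _ xn) ?ball_uniq //= -QE Qyw eqxx big1 ?addr0 //.
  by move=> x; rewrite eq_sym => /negbTE ->; rewrite andbF.
(* The words of rules are now sorted by profile. *)
transitivity (\sum_(y <- ball n | out y == a)
  \sum_(phi <- phis B n | phi_sups phi == alpha)
    (profile_count (rules B) (@rule_key B) fst (inp y) phi)%:R * g y).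
  rewrite big_seq_cond [RHS]big_seq_cond [RHS]big_mkcondr big_mkcondr /=.
  apply: eq_bigr => y; rewrite mem_ball => yn.
  rewrite -mulr_suml -natr_sum -(sum_words_by_profile _ yn) natr_sum mulr_suml.
  case: ifP => ya.
    rewrite [RHS]big_mkcondr; apply: eq_bigr => w _.
    by rewrite /Q ya mul1r.
  by rewrite big1 // => w _; rewrite /Q ya.
rewrite exchange_big /=; apply: eq_bigr => phi /eqP phia.
rewrite (colt_ball _ (n := n)); last first.
  by apply: leq_trans dn; rewrite -phia degree_phi_sums.
rewrite -natrM big_distrr big_mkcondr /=; apply: eq_bigr => y _.
rewrite profile_count_phi natrM.
by case: eqP; rewrite ?mul1r ?mul0r.
Qed.

End Recursion.

(** * The solution of the recursion *)

Section Solution.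

Variables (K : fieldType) (B : bud_generating_system).
Local Notation C := (colors B).
Local Notation budB := (Bud (colors B) (ground B)).
Local Notation rB := (rule_series K (B := B)).
Hypothesis lfO : locally_finite (ground B).
Variable w : C -> nat.
Hypothesis wR :
  forall r : budB, r \in rules B -> (w (out r) < \sum_(c <- inp r) w c)%N.

(** The weight w extended linearly to types. *)
Definition wsum (alpha : {ffun C -> nat}) : nat := (\sum_c alpha c * w c)%N.

Lemma wsum_type_of (u : seq C) : wsum (type_of u) = (\sum_(c <- u) w c)%N.
Proof. by rewrite -sum_count_mem; apply: eq_bigr => c _; rewrite ffunE. Qed.

(** The hypothesis of the induction is used at the types sum phi, which have a
smaller weight than alpha. *)
Lemma recursion_solution (f : xy_series C K) :
  (forall (a : C) (alpha : color_type C),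
      f (xymon a (val alpha)) =
        (val alpha == type_of [:: a])%:R +
        \sum_(phi \in [set phi : phi_map C |
                         val alpha = [ffun c => phi_sup phi c]])
          ((\prod_(b : C) phi_multinomial phi b)%N%:R *
           (phi_weight phi)%:R *
           f (xymon a [ffun b => phi_sum phi b]))) ->
  forall (L : nat) (a : C) (alpha : color_type C), (wsum (val alpha) < L)%N ->
  f (xymon a (val alpha)) =
  \sum_(l < L) colt (cpow rB l) (xymon a (val alpha)).
Proof.
move=> fE; elim=> // L IH a alpha wL; rewrite fE.
rewrite (@fsbig_seq_cond _ _ _ _ _ (phis B (degree (val alpha)))
  (fun phi => phi_sups phi == val alpha)).
- rewrite big_ord_recl colt_unit_series; congr (_ + _).
  under [RHS]eq_bigr do rewrite (colt_cprod_rules lfO _ _ (leqnn _)).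
  rewrite exchange_big /=; apply: eq_bigr => phi /eqP phia.
  rewrite -mulr_sumr; have [->|w0] := eqVneq (phi_weight phi) 0%N.
    by rewrite mulr0 !mul0r.
  have sups0 : phi_sups phi != [ffun=> 0%N] by rewrite phia (valP alpha).
  pose beta : color_type C := exist _ (phi_sums phi) (phi_sums_neq0 sups0).
  have betaL : (wsum (val beta) < L)%N.
    rewrite ltnS in wL; apply: leq_trans wL.
    by have := weight_lt wR w0 sups0; rewrite phia.
  by rewrite -[[ffun b => _]]/(val beta) (IH a beta betaL).
- exact: undup_uniq.
- by move=> phi _ /eqP <-.
- move=> phi /= alphaE /eqP; rewrite !mulf_eq0 !negb_or -andbA => /and3P[_ w0 _].
  rewrite [_ == _](introT eqP (esym alphaE)) andbT; apply: mem_phis.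
    by rewrite alphaE degree_phi_sums.
  by apply: contraNneq w0 => ->.
Qed.

Lemma cpow_eq0 l (x : budB) : (wsum (type_of (inp x)) < l)%N ->
  cpow rB l x = 0.
Proof.
move=> wl; apply/eqP; apply: contraTT wl => nz; rewrite -leqNgt wsum_type_of.
by apply: leq_trans (cpow_weight wR nz); rewrite leq_addl.
Qed.

Lemma cstar_rules L (x : budB) : (wsum (type_of (inp x)) < L)%N ->
  cstar rB x = \sum_(l < L) cpow rB l x.
Proof.
move=> wL; rewrite /cstar (@fsbig_seq_cond _ _ _ _ _ (iota 0 L) xpredT) //.
- by rewrite -(big_mkord xpredT (fun l => cpow rB l x)) /index_iota subn0.
- exact: iota_uniq.
- move=> l _ /eqP; rewrite mem_iota add0n andbT ltnNge; apply: contraNN => Ll.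
  by rewrite cpow_eq0 // (leq_trans wL).
Qed.

Lemma sync_cstar (x : budB) : out x \in initial B ->
  {subset inp x <= terminal B} -> sync K B x = cstar rB x.
Proof.
move=> xI xT; rewrite /sync cprod_units_r; last by move=> c /xT.
by rewrite cprod_units_l.
Qed.

End Solution.

Theorem theorem3p4p8 (K : fieldType) (charK : [pchar K] =i pred0)
    (B : bud_generating_system)
    (unambB : synchronously_unambiguous K B)
    (lfO : locally_finite (ground B))
    (ffR : finitely_factorizes (arity_one [set` rules B]))
    (f : xy_series (colors B) K)
    (fE : forall (a : colors B) (alpha : color_type (colors B)),
      f (xymon a (val alpha)) =
        (val alpha == type_of [:: a])%:R +
        \sum_(phi \in [set phi : phi_map (colors B) |
                         val alpha = [ffun c => phi_sup phi c]])
          ((\prod_(b : colors B) phi_multinomial phi b)%N%:R *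
           (phi_weight phi)%:R *
           f (xymon a [ffun b => phi_sum phi b])))
    (a : colors B) (alpha : color_type (colors B)) :
  a \in initial B ->
  nonempty_words (terminal B) (word_of (val alpha)) ->
  colt (sync K B) (xymon a (val alpha)) = f (xymon a (val alpha)).
Proof.
move=> aI [_ /allP alphaT].
have [w wR] := rule_weight (@bud_locally_finite (colors B) _ lfO) ffR.
rewrite (recursion_solution lfO wR fE a (ltnSn (wsum w (val alpha)))).
under [RHS]eq_bigr do rewrite (colt_ball lfO _ _ (leqnn _)).
rewrite (colt_ball lfO _ _ (leqnn _)) exchange_big.
apply: eq_bigr => x /andP[/eqP xa /eqP xalpha].
rewrite sync_cstar ?xa //; first by apply: (cstar_rules K wR); rewrite xalpha.
move=> c cx; apply: alphaT; rewrite -has_pred1 has_count.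
have /ffunP/(_ c) := etrans (type_of_word_of (val alpha)) (esym xalpha).
by rewrite !ffunE => ->; rewrite -has_count has_pred1.
Qed.
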